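(* Let $\pi\colon H\twoheadrightarrow G$, $\pi'\colon H'\twoheadrightarrow G'$, $\theta\colon H\twoheadrightarrow H'$, $\theta_0\colon G\twoheadrightarrow G'$ be epimorphisms of profinite groups with $\pi'\circ\theta=\theta_0\circ\pi$. Let $$\cdots\xrightarrow{\pi_3}G_2\xrightarrow{\pi_2}G_1\xrightarrow{\pi_1}G_0=G\quad\text{and}\quad\cdots\xrightarrow{\pi'_3}G'_2\xrightarrow{\pi'_2}G'_1\xrightarrow{\pi'_1}G'_0=G'$$ be the fundament series of $\pi$ and $\pi'$, respectively, and let $\rho_k\colon H\twoheadrightarrow G_k$, $\rho'_k\colon H'\twoheadrightarrow G'_k$ be the quotient maps ($k\ge0$). Then (a) there are epimorphisms $\theta_k\colon G_k\twoheadrightarrow G'_k$, $k\ge1$, such that (together with the given $\theta_0$) $\theta_k\circ\rho_k=\rho'_k\circ\theta$ for all $k\ge0$ and $\theta_{k-1}\circ\pi_k=\pi'_k\circ\theta_k$ for all $k\ge1$. (b) If the square formed by $\pi,\theta_0,\theta,\pi'$ is semi-cartesian, then so are, for every $k\ge0$, the square formed by $\rho_k,\theta_k,\theta,\rho'_k$ (with $\theta_k\circ\rho_k=\rho'_k\circ\theta$) and the square formed by $\pi_{k+1},\theta_k,\theta_{k+1},\pi'_{k+1}$ (with $\theta_k\circ\pi_{k+1}=\pi'_{k+1}\circ\theta_{k+1}$). (c) If $\theta_0$ and $\theta$ are isomorphisms, then so is $\theta_k$ for every $k\ge0$.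
   Context: All groups are profinite, homomorphisms are continuous, subgroups are closed; $\twoheadrightarrow$ denotes an epimorphism. For $M\triangleleft H$, $\mathcal{N}_M(H)$ is the set of maximal elements among the normal subgroups of $H$ strictly contained in $M$. The fundament kernel series of $\pi\colon H\twoheadrightarrow G$ is defined by $M_0(\pi)=\operatorname{Ker}\pi$ and $M_i(\pi)=\bigcap_{N\in\mathcal{N}_{M_{i-1}(\pi)}(H)}N$ for $i\ge1$ (understood as $M_{i-1}(\pi)$ if $M_{i-1}(\pi)=1$). The fundament series of $\pi$ is the sequence of induced quotient maps $\pi_i\colon G_i\twoheadrightarrow G_{i-1}$, $i\ge1$, where $G_i=H/M_i(\pi)$ and $G_0=H/\operatorname{Ker}\pi$ is identified with $G$ via $\pi$ (so $\rho_0=\pi$). A commutative square of epimorphisms $\eta\colon H\twoheadrightarrow G$, $\beta\colon H\twoheadrightarrow B$, $\alpha\colon B\twoheadrightarrow A$, $\varphi\colon G\twoheadrightarrow A$ with $\alpha\circ\beta=\varphi\circ\eta$ is semi-cartesian if $\eta(\operatorname{Ker}\beta)=\operatorname{Ker}\varphi$ (equivalently, $\beta(\operatorname{Ker}\eta)=\operatorname{Ker}\alpha$). *)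

(* Defs.v *)
From HB Require Import structures.
From mathcomp Require Import all_boot all_classical.
From mathcomp Require Import topology_structure product_topology.
From mathcomp Require Import quotient_topology compact connected.
From mathcomp Require Import subspace_topology separation_axioms.

Set Implicit Arguments.
Unset Strict Implicit.
Unset Printing Implicit Defensive.

Local Open Scope classical_set_scope.
Local Open Scope quotient_scope.
Local Open Scope group_scope.

HB.mixin Record Group_isTopological G of Group G & Topological G := {
  mulg_continuous : continuous (fun xy : G * G => xy.1 * xy.2);
  invg_continuous : continuous (fun x : G => x^-1)
}.

#[short(type="topologicalGroupType")]
HB.structure Definition TopologicalGroup :=
  {G of Group G & Topological G & Group_isTopological G}.

HB.mixin Record TopologicalGroup_isProfinite G of TopologicalGroup G := {
  profinite_compact : compact [set: G];
  profinite_hausdorff : hausdorff_space G;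
  profinite_totally_disconnected : totally_disconnected [set: G]
}.

#[short(type="profiniteGroupType")]
HB.structure Definition ProfiniteGroup :=
  {G of TopologicalGroup G & TopologicalGroup_isProfinite G}.

Lemma mulgl_continuous (H : topologicalGroupType) (x : H) : continuous (fun y : H => x * y).
Proof.
move=> y; apply: (@cvg_comp _ _ _ (fun z => (x, z))
  (fun xz : H * H => xz.1 * xz.2) _ (nbhs (x, y))).
  by apply: cvg_pair; [exact: cvg_cst|exact: cvg_id].
exact: (@mulg_continuous H (x, y)).
Qed.

Lemma mulgr_continuous (H : topologicalGroupType) (x : H) : continuous (fun y : H => y * x).
Proof.
move=> y; apply: (@cvg_comp _ _ _ (fun z => (z, x))
  (fun xz : H * H => xz.1 * xz.2) _ (nbhs (y, x))).
  by apply: cvg_pair; [exact: cvg_id|exact: cvg_cst].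
exact: (@mulg_continuous H (y, x)).
Qed.

Record epimorphism (H G : topologicalGroupType) := Epimorphism {
  epi_fun :> H -> G;
  epiM : {morph epi_fun : x y / x * y};
  epi_continuous : continuous epi_fun;
  epi_surj : forall y, exists x, epi_fun x = y
}.

Definition isomorphism (H G : topologicalGroupType) (f : epimorphism H G) :=
  exists g : epimorphism G H, cancel f g /\ cancel g f.

Definition ker (H G : groupType) (f : H -> G) : set H := f @^-1` [set 1].

Definition semi_cartesian (H G B A : topologicalGroupType)
    (eta : epimorphism H G) (beta : epimorphism H B)
    (alpha : epimorphism B A) (phi : epimorphism G A) :=
  (forall h, alpha (beta h) = phi (eta h)) /\ eta @` ker beta = ker phi.

Lemma epi1 (H G : topologicalGroupType) (f : epimorphism H G) : f 1 = 1.
Proof. by apply: (@mulgI _ (f 1)); rewrite -epiM !mulg1. Qed.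

Lemma epiV (H G : topologicalGroupType) (f : epimorphism H G) :
  {morph f : x / x^-1}.
Proof.
by move=> x; apply: (@mulgI _ (f x)); rewrite -epiM !mulgV epi1.
Qed.

(* Subgroups of profinite groups are closed by convention. *)
Definition normal_subgroup (H : topologicalGroupType) (N : set H) :=
  [/\ closed N, N 1, (forall x y, N x -> N y -> N (x / y))
    & (forall x y, N x -> N (x ^ y))].

Definition max_normal (H : topologicalGroupType) (M : set H) : set (set H) :=
  [set N | [/\ normal_subgroup N, N `<` M &
    forall N', normal_subgroup N' -> N' `<` M -> N `<=` N' -> N' = N]].

(* The intersection is taken inside M, so that it is M when max_normal M is
   empty; for H profinite this only happens when M is trivial. *)
Definition fundament_of (H : topologicalGroupType) (M : set H) : set H :=
  M `&` \bigcap_(N in max_normal M) N.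

Fixpoint fundament_kernel (H G : topologicalGroupType) (f : H -> G) (k : nat)
    : set H :=
  if k is k'.+1 then fundament_of (fundament_kernel f k') else ker f.

Lemma normal_ker (H G : profiniteGroupType) (f : epimorphism H G) :
  normal_subgroup (ker f).
Proof.
split; rewrite /ker /=.
- apply: preimage_closed; first by move=> x _; exact: epi_continuous.
  exact/accessible_closed_set1/hausdorff_accessible/profinite_hausdorff.
- exact: epi1.
- by move=> x y fx fy; rewrite /= epiM epiV fx fy mulgV.
- by move=> x y fx; rewrite /conjg /= !epiM epiV fx mul1g mulVg.
Qed.

Lemma normal_fundament_of (H : topologicalGroupType) (M : set H) :
  normal_subgroup M -> normal_subgroup (fundament_of M).
Proof.
move=> [Mcl M1 MF MJ]; split.
- by apply: closedI => //; apply: closed_bigI => N [[]].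
- by split=> // N [[]].
- move=> x y [Mx Nx] [My Ny]; split; first exact: MF.
  move=> N NM; have [[_ _ NF _] _ _] := NM.
  by apply: NF; [exact: Nx|exact: Ny].
- move=> x y [Mx Nx]; split; first exact: MJ.
  by move=> N NM; have [[_ _ _ NJ] _ _] := NM; apply: NJ; exact: Nx.
Qed.

Lemma normal_fundament_kernel (H G : profiniteGroupType)
    (f : epimorphism H G) k : normal_subgroup (fundament_kernel f k).
Proof.
elim: k => [|k IHk]; [exact: normal_ker|exact: normal_fundament_of].
Qed.

Lemma compact_zero_dimensional (T : topologicalType) :
  hausdorff_space T -> compact [set: T] -> totally_disconnected [set: T] ->
  zero_dimensional T.
Proof.
move=> hT cT tT x y xy; apply: contrapT => noU.
pose F := filter_from [set D : set T | D x /\ clopen D] id.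
have FF : Filter F.
  apply: filter_from_filter; first by exists setT; split => //; exact: clopenT.
  by move=> A B [? ?] [? ?]; exists (A `&` B) => //; split=> //; exact: clopenI.
have PF : ProperFilter F.
  by apply: filter_from_proper => D [Dx _]; exists x.
pose K := [set z | forall D : set T, D x -> clopen D -> D z].
have Kcl : closed K.
  rewrite (_ : K = \bigcap_(D in [set D | D x /\ clopen D]) D).
    by apply: closed_bigI => D [_ []].
  by rewrite eqEsubset; split=> z; [move=> Kz D []; exact: Kz|
    move=> Kz D Dx cD; apply: Kz].
have Kx : K x by [].
have Ky : K y.
  move=> D Dx cD; apply: contrapT => nDy; apply: noU.
  by exists D.
suff Kc : connected K.
  have : connected_component [set: T] x y by exists K.
  by rewrite tT// => /= yx; move: xy; rewrite yx eqxx.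
have KU U : open U -> K `<=` U -> exists2 D, D x /\ clopen D & D `<=` U.
  move=> Uop KU; have /compact_near_coveringP : compact (~` U).
    by apply: (subclosed_compact _ cT) => //; exact: open_closedC.
  move=> /(_ _ _ setC (powerset_filter_from_filter PF))[].
    move=> z nUz; have [D [Dx cD nDz]] : exists D, [/\ D x, clopen D & ~ D z].
      apply: contrapT => nD; apply/nUz/KU => D Dx cD.
      by apply: contrapT => nDz; apply: nD; exists D.
    exists (~` D, [set V | V `<=` D]); first split.
    - apply: open_nbhs_nbhs; split => //.
      by apply: closed_openC; case: cD.
    - apply/near_powerset_filter_fromP; first by move=> ? ?; exact: subset_trans.
      by exists D => //; exists D.
    - by case=> i j [? /subsetC]; apply.
  move=> B [BF _ [C CB]] /(_ _ CB) nU.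
  have [D DF DC] := BF _ CB; exists D => // z Dz.
  by apply: contrapT => /nU; apply; exact: DC.
move=> B [b Bb] [C1 C1op BC1] [C2 C2cl BC2].
have Bcl : closed B by rewrite BC2; exact: closedI.
pose A := K `&` ~` C1.
have Acl : closed A by apply: closedI => //; exact: open_closedC.
have AB z : K z -> A z \/ B z.
  by move=> Kz; have [Cz|nCz] := pselect (C1 z); [right; rewrite BC1|left].
have nAB z : A z -> ~ B z by rewrite BC1 => -[_ nC] [_ /nC].
have [V [Vop BV clVA]] :
    exists V, [/\ open V, B `<=` V & closure V `<=` ~` A].
  have snB : set_nbhs B (~` A).
    move=> z Bz; apply: open_nbhs_nbhs; split; first exact: closed_openC.
    by move=> /nAB /(_ Bz).
  have [W /set_nbhsP[V [Vop BV VW]] WA] := compact_normal hT cT Bcl snB.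
  exists V; split => //.
  by apply: subset_trans WA; exact: closureS.
have [D [Dx [Dop Dcl]] DV] : exists2 D, D x /\ clopen D &
    D `<=` V `|` ~` closure V.
  apply: KU; first by apply: openU => //; exact/closed_openC/closed_closure.
  move=> z /AB[Az|/BV]; last by left.
  by right => /clVA.
have cDV : clopen (D `&` V).
  split; first exact: openI.
  rewrite (_ : D `&` V = D `&` closure V).
    by apply: closedI => //; exact: closed_closure.
  rewrite eqEsubset; split=> z [Dz Vz]; split=> //.
    exact: subset_closure.
  by have [] := DV _ Dz.
have Kb : K b by move: Bb; rewrite BC1 => -[].
have BK : B `<=` K by rewrite BC1; exact: subIsetl.
have [Vx|nVx] := pselect (V x).
  rewrite eqEsubset; split=> // z Kz.
  have [_ Vz] := Kz _ (conj Dx Vx) cDV.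
  have [Az|//] := AB _ Kz.
  by have := clVA _ (subset_closure Vz).
have [_] : (D `&` ~` (D `&` V)) b.
  apply: Kb; first by split => // -[].
  by apply: clopenI => //; exact: clopenC.
by case; split; [exact: Kb|exact: BV].
Qed.

Lemma open_subgroup (H : profiniteGroupType) (W : set H) : nbhs 1 W ->
  exists U : set H, [/\ open U, U 1,
    forall x y, U x -> U y -> U (x / y) & U `<=` W].
Proof.
move=> nW.
have zH : zero_dimensional H.
  apply: compact_zero_dimensional; [exact: profinite_hausdorff|
    exact: profinite_compact|exact: profinite_totally_disconnected].
have [C [C1 [Cop Ccl]] CW] := zero_dimensional_cvg profinite_hausdorff zH
  profinite_compact nW.
pose U := [set u : H | forall c, C c -> C (c * u) /\ C (c / u)].
have U1 : U 1 by move=> c Cc; rewrite invg1 !mulg1.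
have UF x y : U x -> U y -> U (x / y).
  move=> Ux Uy c Cc; split.
    by rewrite mulgA; apply: (Uy _ _).2; apply: (Ux _ _).1.
  by rewrite invgM invgK mulgA; apply: (Ux _ _).2; apply: (Uy _ _).1.
have nU : nbhs 1 U.
  pose U0 := [set u : H | forall c, C c -> C (c * u)].
  have nU0 : nbhs 1 U0.
    have /compact_near_coveringP : compact C.
      exact: (subclosed_compact Ccl profinite_compact).
    move=> /(_ H (nbhs 1) (fun u c => C (c * u))); apply => c Cc.
    apply: (@mulg_continuous H (c, 1)); rewrite /= mulg1.
    exact: open_nbhs_nbhs.
  have nVU0 : nbhs 1 ((fun u : H => u^-1) @^-1` U0).
    by apply: invg_continuous; rewrite invg1.
  by apply: filterS (filterI nU0 nVU0) => u [Uu UVu] c Cc; split;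
    [exact: Uu|exact: UVu].
exists U; split => //; last first.
  by move=> u /(_ _ C1)[+ _]; rewrite mul1g => /CW.
rewrite openE => v Uv.
have : nbhs v ((fun x => v^-1 * x) @^-1` U).
  by apply: mulgl_continuous; rewrite mulVg.
apply: filterS => x /= Uvx.
have UV : U (v^-1 * x)^-1 by rewrite -[X in U X]mul1g; exact: UF.
by rewrite -[x](mulVKg v) -[v^-1 * x]invgK; exact: UF.
Qed.

Record normalSubgroup (H : topologicalGroupType) := NormalSubgroup {
  normal_set :> set H;
  normalP : normal_subgroup normal_set
}.

Section Quotient.
Context {H : topologicalGroupType}.
Implicit Types (N : normalSubgroup H) (x y : H).

Lemma normal_closed N : closed (normal_set N). Proof. by case: (normalP N). Qed.
Lemma normal1 N : normal_set N 1. Proof. by case: (normalP N). Qed.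
Lemma normalF N x y : normal_set N x -> normal_set N y -> normal_set N (x / y).
Proof. by case: (normalP N) => _ _ + _; apply. Qed.
Lemma normalV N x : normal_set N x -> normal_set N x^-1.
Proof. by rewrite -[x^-1]mul1g; apply: normalF; exact: normal1. Qed.
Lemma normalM N x y : normal_set N x -> normal_set N y -> normal_set N (x * y).
Proof. by move=> Nx /normalV; rewrite -{2}[y]invgK; exact: normalF. Qed.
Lemma normalJ N x y : normal_set N x -> normal_set N (x ^ y).
Proof. by case: (normalP N) => _ _ _; apply. Qed.

Definition same_coset N x y : bool := `[< normal_set N (x^-1 * y) >].

Lemma same_coset_refl N : reflexive (same_coset N).
Proof. by move=> x; apply/asboolP; rewrite mulVg; exact: normal1. Qed.

Lemma same_coset_sym N : symmetric (same_coset N).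
Proof.
by move=> x y; apply/asboolP/asboolP => /normalV; rewrite invgM invgK.
Qed.

Lemma same_coset_trans N : transitive (same_coset N).
Proof.
move=> y x z /asboolP xy /asboolP yz; apply/asboolP.
by have := normalM xy yz; rewrite mulgA mulgK.
Qed.

Canonical same_coset_equiv N :=
  EquivRel (same_coset N) (same_coset_refl N) (same_coset_sym N)
    (@same_coset_trans N).

End Quotient.

Definition quotient_group (H : topologicalGroupType) (N : normalSubgroup H) :
  Type := quotient_topology {eq_quot same_coset_equiv N}.

Section QuotientGroup.
Context {H : topologicalGroupType} (N : normalSubgroup H).
Implicit Types x y : H.
Local Notation Q := (quotient_group N).

HB.instance Definition _ := Quotient.on Q.
HB.instance Definition _ := Topological.on Q.

Definition quotient_proj x : Q := \pi_Q x.
Local Notation q := quotient_proj.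

Lemma quotient_projP x y : q x = q y <-> normal_set N (x^-1 * y).
Proof.
split=> [/(eqmodP (same_coset_equiv N))/asboolP //|Nxy].
by apply/(eqmodP (same_coset_equiv N))/asboolP.
Qed.

Lemma quotient_projK (a : Q) : q (repr a) = a.
Proof. exact: reprK. Qed.

Lemma quotient_repr x : normal_set N ((repr (q x))^-1 * x).
Proof. by apply/quotient_projP; rewrite quotient_projK. Qed.

Definition quotient_mul (a b : Q) := q (repr a * repr b).
Definition quotient_inv (a : Q) := q (repr a)^-1.

Lemma quotient_mulE x y : quotient_mul (q x) (q y) = q (x * y).
Proof.
apply/quotient_projP; set u := repr _; set v := repr _.
have Nux : normal_set N (u^-1 * x) := quotient_repr x.
have Nvy : normal_set N (v^-1 * y) := quotient_repr y.
have -> : (u * v)^-1 * (x * y) = (u^-1 * x) ^ v * (v^-1 * y).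
  by rewrite /conjg invgM !mulgA mulgK.
by apply: normalM => //; exact: normalJ.
Qed.

Lemma quotient_invE x : quotient_inv (q x) = q x^-1.
Proof.
apply/quotient_projP; set u := repr _; rewrite invgK.
have Nux : normal_set N (u^-1 * x) := quotient_repr x.
have -> : u * x^-1 = (u^-1 * x)^-1 ^ u^-1.
  by rewrite /conjg invgM !invgK mulgK.
exact/normalJ/normalV.
Qed.

Let quotient_mulA : associative quotient_mul.
Proof.
move=> a b c; rewrite -[a]quotient_projK -[b]quotient_projK -[c]quotient_projK.
by rewrite !quotient_mulE mulgA.
Qed.

Let quotient_mul1 : left_id (q 1) quotient_mul.
Proof. by move=> a; rewrite -[a]quotient_projK quotient_mulE mul1g. Qed.

Let quotient_mulr1 : right_id (q 1) quotient_mul.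
Proof. by move=> a; rewrite -[a]quotient_projK quotient_mulE mulg1. Qed.

Let quotient_mulV : left_inverse (q 1) quotient_inv quotient_mul.
Proof.
by move=> a; rewrite -[a]quotient_projK quotient_invE quotient_mulE mulVg.
Qed.

Let quotient_mulrV : right_inverse (q 1) quotient_inv quotient_mul.
Proof.
by move=> a; rewrite -[a]quotient_projK quotient_invE quotient_mulE mulgV.
Qed.

HB.instance Definition _ := isGroup.Build Q quotient_mulA quotient_mul1
  quotient_mulr1 quotient_mulV quotient_mulrV.

Lemma quotient_projM : {morph q : x y / x * y}.
Proof. by move=> x y; rewrite -quotient_mulE. Qed.

Lemma quotient_projV : {morph q : x / x^-1}.
Proof. by move=> x; rewrite -quotient_invE. Qed.

Lemma quotient_proj_continuous : continuous q.
Proof. exact: pi_continuous. Qed.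

Lemma quotient_proj_open (U : set H) : open U -> open (q @` U).
Proof.
move=> Uop; change (open (q @^-1` (q @` U))).
have <- : \bigcup_(n in normal_set N) ((fun x => x * n^-1) @^-1` U) =
    q @^-1` (q @` U).
  rewrite eqEsubset; split=> x /=.
    move=> [n Nn Ux]; exists (x * n^-1) => //; apply/quotient_projP.
    by rewrite invgM invgK mulgVK.
  move=> [u Uu /quotient_projP Nux]; exists (u^-1 * x) => //=.
  by rewrite invgM invgK mulgA mulgV mul1g.
apply: bigcup_open => n _; apply: open_comp => // x _.
exact: mulgr_continuous.
Qed.

Lemma quotient_proj_nbhs x (U : set H) : nbhs x U -> nbhs (q x) (q @` U).
Proof.
rewrite nbhsE => -[V [Vop Vx] VU]; apply: (@filterS _ _ _ (q @` V)).
  exact: image_subset.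
by apply: open_nbhs_nbhs; split; [exact: quotient_proj_open|exists x].
Qed.

Let quotient_mul_continuous : continuous (fun ab : Q * Q => ab.1 * ab.2).
Proof.
move=> -[a b] W; rewrite -[a]quotient_projK -[b]quotient_projK /=.
rewrite -quotient_projM => /quotient_proj_continuous.
move=> /(@mulg_continuous H (repr a, repr b))[[U V]] /= [nU nV] UVW.
exists (q @` U, q @` V) => /=; first by split; exact: quotient_proj_nbhs.
move=> [_ _] [/= [x Ux <-] [y Vy <-]]; rewrite -quotient_projM.
exact: (UVW (x, y)).
Qed.

Let quotient_inv_continuous : continuous (fun a : Q => a^-1).
Proof.
move=> a W; rewrite -[a]quotient_projK -quotient_projV.
move=> /quotient_proj_continuous /(@invg_continuous H (repr a)).
move=> /quotient_proj_nbhs; apply: filterS => _ [x + <-] /=.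
by rewrite -quotient_projV.
Qed.

HB.instance Definition _ := Group_isTopological.Build Q
  quotient_mul_continuous quotient_inv_continuous.

Lemma quotient_proj_surj a : exists x, q x = a.
Proof. by exists (repr a); exact: quotient_projK. Qed.

Definition quotient_epi : epimorphism H Q :=
  Epimorphism quotient_projM quotient_proj_continuous quotient_proj_surj.

Lemma ker_quotient : ker quotient_epi = normal_set N.
Proof.
rewrite eqEsubset; split=> x; rewrite /ker /=.
- by move/esym/quotient_projP; rewrite invg1 mul1g.
- by move=> Nx; apply/esym/quotient_projP; rewrite invg1 mul1g.
Qed.

End QuotientGroup.

Section ProfiniteQuotient.
Context {H : profiniteGroupType} (N : normalSubgroup H).
Local Notation Q := (quotient_group N).
Local Notation q := (@quotient_proj H N).

Let quotient_zero_dimensional : zero_dimensional Q.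
Proof.
move=> a b; rewrite -[a]quotient_projK -[b]quotient_projK.
move: (repr a) (repr b) => x y /eqP qxy.
pose z := x^-1 * y.
have nz : ~ normal_set N z by move=> /quotient_projP.
have [U [Uop U1 UF UW]] : exists U : set H, [/\ open U, U 1,
    forall x y, U x -> U y -> U (x / y) &
    U `<=` (fun u => u^-1 * z) @^-1` (~` normal_set N)].
  apply: open_subgroup.
  have nNz : nbhs z (~` normal_set N).
    by apply: open_nbhs_nbhs; split => //; exact/closed_openC/normal_closed.
  have := @mulgr_continuous H z 1; rewrite /continuous_at /= mul1g => /(_ _ nNz) nW.
  have := @invg_continuous H 1; rewrite /continuous_at invg1 => /(_ _ nW) nI.
  exact: nI.
pose V (w : H) := q @` ((fun u => w^-1 * u) @^-1` U).
have Vop w : open (V w).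
  apply: quotient_proj_open; apply: open_comp => // u _.
  exact: mulgl_continuous.
have VE w u : V w (q u) <-> exists2 t, U t & q (w * t) = q u.
  split=> [[s /= Us <-]|[t Ut <-]].
    by exists (w^-1 * s) => //; rewrite mulVKg.
  by exists (w * t) => //=; rewrite mulKg.
exists (V x); split.
- split => //; rewrite -[V x]setCK; apply: open_closedC.
  rewrite (_ : ~` V x = \bigcup_(w in [set w | ~ V x (q w)]) V w).
    exact: bigcup_open.
  rewrite eqEsubset; split=> c; rewrite -[c]quotient_projK.
    move: (repr c) => w nVw; exists w => //; apply/VE; exists 1 => //.
    by rewrite mulg1.
  move: (repr c) => u [w /= nVw] /VE[t Ut wtu] /VE[s Us xsu].
  apply: nVw; apply/VE; exists (s / t); first exact: UF.
  by rewrite mulgA quotient_projM xsu -wtu -quotient_projM mulgK.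
- by apply/VE; exists 1 => //; rewrite mulg1.
- move=> /VE[t Ut] /quotient_projP; rewrite invgM -mulgA.
  exact: (UW _ Ut).
Qed.

Let quotient_compact : compact [set: Q].
Proof.
rewrite (_ : [set: Q] = q @` [set: H]).
  apply: continuous_compact; last exact: profinite_compact.
  exact/continuous_subspaceT/quotient_proj_continuous.
by rewrite eqEsubset; split=> // a _; exists (repr a); rewrite ?quotient_projK.
Qed.

Let quotient_hausdorff : hausdorff_space Q.
Proof.
rewrite open_hausdorff => a b /quotient_zero_dimensional[U [[Uop Ucl] Ua Ub]].
exists (U, ~` U); first by rewrite !inE.
by split => //=; [exact: closed_openC|rewrite setICr].
Qed.

HB.instance Definition _ := TopologicalGroup_isProfinite.Build Q
  quotient_compact quotient_hausdorff
  (zero_dimension_totally_disconnected quotient_zero_dimensional).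

End ProfiniteQuotient.

Section QuotientLift.
Context {H G : topologicalGroupType} (N : normalSubgroup H).
Variables (f : epimorphism H G) (Nf : normal_set N `<=` ker f).
Local Notation Q := (quotient_group N).

Definition quotient_lift_fun (a : Q) : G := f (repr a).

Lemma quotient_liftE x : quotient_lift_fun (quotient_proj N x) = f x.
Proof.
have /Nf := quotient_repr N x; rewrite /ker /= epiM epiV => fx.
by rewrite /quotient_lift_fun -[LHS]mulg1 -fx mulVKg.
Qed.

Let quotient_liftM : {morph quotient_lift_fun : a b / a * b}.
Proof.
move=> a b; rewrite -[a]quotient_projK -[b]quotient_projK -quotient_projM.
by rewrite !quotient_liftE epiM.
Qed.

Let quotient_lift_continuous : continuous quotient_lift_fun.
Proof.
apply/quotient_continuous; rewrite (_ : _ \o _ = f); first exact: epi_continuous.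
by apply/funext => x; exact: quotient_liftE.
Qed.

Let quotient_lift_surj y : exists a, quotient_lift_fun a = y.
Proof.
have [x <-] := epi_surj f y.
by exists (quotient_proj N x); exact: quotient_liftE.
Qed.

Definition quotient_lift : epimorphism Q G :=
  Epimorphism quotient_liftM quotient_lift_continuous quotient_lift_surj.

End QuotientLift.

(* G_0 = H / Ker f is identified with G, so that fundament_proj f 0 is f;
   fundament_map f k goes from G_(k+1) to G_k. *)

Section FundamentSeries.
Context {H G : profiniteGroupType} (f : epimorphism H G).

Definition fundament_normal k : normalSubgroup H :=
  NormalSubgroup (normal_fundament_kernel f k).

Definition fundament_group (k : nat) : profiniteGroupType :=
  if k is k'.+1 then quotient_group (fundament_normal k'.+1) else G.

Definition fundament_proj (k : nat) : epimorphism H (fundament_group k) :=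
  if k is k'.+1 then quotient_epi (fundament_normal k'.+1) else f.

Lemma ker_fundament_proj k : ker (fundament_proj k) = fundament_kernel f k.
Proof. by case: k => [//|k]; exact: ker_quotient. Qed.

Lemma fundament_kernel_sub k :
  normal_set (fundament_normal k.+1) `<=` ker (fundament_proj k).
Proof. by rewrite ker_fundament_proj => x []. Qed.

Definition fundament_map (k : nat) :
    epimorphism (fundament_group k.+1) (fundament_group k) :=
  quotient_lift (@fundament_kernel_sub k).

Lemma fundament_mapE k x :
  fundament_map k (fundament_proj k.+1 x) = fundament_proj k x.
Proof. exact: quotient_liftE (@fundament_kernel_sub k) x. Qed.

End FundamentSeries.

Definition fundament_ladder (H G H' G' : profiniteGroupType)
    (f : epimorphism H G) (f' : epimorphism H' G')
    (theta : epimorphism H H') (theta0 : epimorphism G G')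
    (t : forall k, epimorphism (fundament_group f k) (fundament_group f' k)) :=
  [/\ t 0%N =1 theta0,
      forall k h, t k (fundament_proj f k h) = fundament_proj f' k (theta h)
    & forall k g, t k (fundament_map f k g) = fundament_map f' k (t k.+1 g)].

(* Main.v *)
Require Import Defs.
From mathcomp Require Import all_boot all_classical.
From mathcomp Require Import topology_structure product_topology.
From mathcomp Require Import compact subspace_topology separation_axioms.

(** The kernel of the [k]-th projection [rho_k] is the [k]-th term [M_k] of the
fundament kernel series of [pi], so the whole theorem is about how [theta]
moves these kernels: [theta_k] exists as soon as [theta] maps [M_k] into
[M'_k], and the square on [rho_k] and [theta] is semi-cartesian exactly when
[theta] maps [M_k] onto [M'_k].  Write [F M] for the fundament of [M], the
intersection of the maximal proper normal subgroups of [M].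

Inclusions propagate from [M] to [F M] ([image_fundament_sub]): if [theta]
maps [M] into [M'] and [N'] is maximal in [M'], then [M] meets the preimage
of [N'] either in all of [M] or in a maximal normal subgroup of [M], because
the normal subgroup [theta M] either lies in [N'] or spans [M'] together with
[N'].  In both cases [theta] maps [F M] into [N'].

Equalities propagate too ([image_fundament]), and this is the substantial
point.  Suppose [theta M = M'].  By compactness and Zorn there is a minimal
normal subgroup [C] of [H] inside [M] that still maps onto [M']
([minimal_cover]).  Minimality forces the part of [C] killed by [theta] into
every maximal [N], just as a minimal supplement meets what it supplements in
the Frattini subgroup ([minimal_cover_ker]).  So nothing is lost about the
maximal subgroups in passing from [C] to its image: for [N] maximal in [M] and
not containing [C], the image of [C `&` N] is maximal in [M']
([max_normal_image]), and a lift to [C] of an element of [F M'] lies in every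
such [N].

Being semi-cartesian does not depend on the order in which the two sides of
the square are listed ([semi_cartesianC]), so the case [k = 0] of the equality
is the hypothesis of the second statement.  Injectivity of [theta_k] is no
separate issue in the third statement, for the inverses of [theta] and
[theta_0] induce maps on the series as well, and these invert [theta_k]. *)

Set Implicit Arguments.
Unset Strict Implicit.
Unset Printing Implicit Defensive.

Local Open Scope classical_set_scope.
Local Open Scope group_scope.

(** * Operations on closed normal subgroups *)

Section NormalSubgroups.
Context {H : topologicalGroupType}.
Implicit Types (A N : set H) (x y : H).

Lemma normal_subgroupV N x : normal_subgroup N -> N x -> N x^-1.
Proof. by move=> nN; exact: (@normalV _ (NormalSubgroup nN)). Qed.

Lemma normal_subgroupM N x y : normal_subgroup N -> N x -> N y -> N (x * y).
Proof. by move=> nN; exact: (@normalM _ (NormalSubgroup nN)). Qed.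

Lemma normal_subgroupI A N :
  normal_subgroup A -> normal_subgroup N -> normal_subgroup (A `&` N).
Proof.
move=> [Acl A1 AF AJ] [Ncl N1 NF NJ].
split=> [|//|x y [Ax Nx] [Ay Ny]|x y [Ax Nx]].
- exact: closedI.
- by split; [exact: AF|exact: NF].
- by split; [exact: AJ|exact: NJ].
Qed.

End NormalSubgroups.

Lemma normal_preimage (H G : topologicalGroupType) (f : epimorphism H G)
    (N : set G) : normal_subgroup N -> normal_subgroup (f @^-1` N).
Proof.
move=> [Ncl N1 NF NJ]; split=> [||x y Nx Ny|x y Nx] /=.
- by apply: preimage_closed => // x _; exact: epi_continuous.
- by rewrite epi1.
- by rewrite epiM epiV; exact: NF.
- by rewrite /conjg !epiM epiV; exact: NJ.
Qed.

Lemma normal_image (H G : profiniteGroupType) (f : epimorphism H G)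
    (N : set H) : normal_subgroup N -> normal_subgroup (f @` N).
Proof.
move=> [Ncl N1 NF NJ]; split.
- apply: (compact_closed profinite_hausdorff); apply: continuous_compact.
    exact/continuous_subspaceT/epi_continuous.
  exact: (subclosed_compact Ncl profinite_compact).
- by exists 1; rewrite ?epi1.
- move=> _ _ [x Nx <-] [y Ny <-]; exists (x / y); first exact: NF.
  by rewrite epiM epiV.
- move=> _ y [x Nx <-]; have [z <-] := epi_surj f y.
  by exists (x ^ z); [exact: NJ|rewrite /conjg !epiM epiV].
Qed.

Lemma normal_mul (H : profiniteGroupType) (A B : set H) :
  normal_subgroup A -> normal_subgroup B ->
  normal_subgroup ((fun ab : H * H => ab.1 * ab.2) @` (A `*` B)).
Proof.
move=> nA nB; have [Acl A1 AF AJ] := nA; have [Bcl B1 BF BJ] := nB; split.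
- apply: (compact_closed profinite_hausdorff); apply: continuous_compact.
    exact/continuous_subspaceT/mulg_continuous.
  by apply: compact_setX; [exact: (subclosed_compact Acl profinite_compact)|
    exact: (subclosed_compact Bcl profinite_compact)].
- by exists (1, 1); rewrite //= mulg1.
- move=> _ _ [[a b] [/= Aa Bb] <-] [[c d] [/= Ac Bd] <-].
  exists (a / c, (b / d) ^ c^-1).
    by split; [exact: AF|exact/BJ/BF].
  by rewrite /= /conjg invgK invgM !mulgA mulgVK.
- move=> _ y [[a b] [/= Aa Bb] <-]; exists (a ^ y, b ^ y).
    by split; [exact: AJ|exact: BJ].
  by rewrite /= conjMg.
Qed.

(** * Maximal normal subgroups *)

(** Modulo [N] the group [M] is a minimal normal subgroup, so the image there
of a normal subgroup [A] is trivial or everything. *)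
Lemma max_normal_dichotomy (H : profiniteGroupType) (M N A : set H) :
  normal_subgroup M -> max_normal M N -> normal_subgroup A -> A `<=` M ->
  A `<=` N \/ forall x, M x -> exists2 a, A a & N (a^-1 * x).
Proof.
move=> nM [nN [NM nMN] maxN] nA AM.
pose P := (fun ab : H * H => ab.1 * ab.2) @` (A `*` N).
have nP : normal_subgroup P by exact: normal_mul.
have [_ A1 _ _] := nA; have [_ N1 _ _] := nN.
have NP : N `<=` P by move=> x Nx; exists (1, x); rewrite //= mul1g.
have AP : A `<=` P by move=> x Ax; exists (x, 1); rewrite //= mulg1.
have PM : P `<=` M.
  by move=> _ [[a x] [/= /AM Ma /NM Mx] <-]; exact: normal_subgroupM.
have [MP|nMP] := pselect (M `<=` P); [right|left].
  by move=> x /MP [[a y] [/= Aa Ny] <-]; exists a; rewrite ?mulKg.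
by rewrite -(maxN P).
Qed.

Section InducedOnFundament.
Context {H H' : profiniteGroupType} (theta : epimorphism H H').
Variables (M : set H) (M' : set H').
Hypotheses (nM : normal_subgroup M) (nM' : normal_subgroup M').

(** If [x] lies in [M] and not in [theta @^-1` N'], then [M'] is
[theta M * N'], so that [M / (M `&` theta @^-1` N')] is a copy of [M' / N'];
correspondingly [M `&` theta @^-1` N'] is maximal in [M]. *)
Lemma max_normal_preimage (N' : set H') :
  theta @` M `<=` M' -> max_normal M' N' -> ~ theta @` M `<=` N' ->
  max_normal M (M `&` theta @^-1` N').
Proof.
move=> MM' maxN' nMN'; have [nN' [N'M' _] _] := maxN'.
split=> [||P nP [PM nMP] NP].
- by apply: normal_subgroupI => //; exact: normal_preimage.
- by split=> [x []//|MN]; apply: nMN' => _ [x /MN[_ N'x] <-].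
have PM' : theta @` P `<=` M'.
  by move=> _ [x Px <-]; apply: MM'; exists x => //; exact: PM.
have [PN'|MPN'] := max_normal_dichotomy nM' maxN' (normal_image theta nP) PM'.
  rewrite eqEsubset; split=> // x Px; split; first exact: PM.
  by apply: PN'; exists x.
case: nMP => x Mx; have /MPN' [_ [p Pp <-]] : M' (theta x).
  by apply: MM'; exists x.
rewrite -epiV -epiM => N'px; rewrite -(mulVKg p x).
apply: (normal_subgroupM nP) => //; apply: NP; split => //.
by apply: (normal_subgroupM nM) => //; apply: (normal_subgroupV nM); exact: PM.
Qed.

Lemma image_fundament_sub :
  theta @` M `<=` M' -> theta @` fundament_of M `<=` fundament_of M'.
Proof.
move=> MM' _ [x [Mx FMx] <-]; split; first by apply: MM'; exists x.
move=> N' maxN'; have [MN'|nMN'] := pselect (theta @` M `<=` N').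
  by apply: MN'; exists x.
by have [] := FMx _ (max_normal_preimage MM' maxN' nMN').
Qed.

End InducedOnFundament.

(** * Minimal covers *)

Lemma compact_chain_bigcap (T : topologicalType) (I : Type) (D : set I)
    (f : I -> set T) (K : set T) :
  compact K -> K !=set0 -> (forall i, D i -> closed (f i)) ->
  total_on D (fun i j => f i `<=` f j) ->
  (forall i, D i -> K `&` f i !=set0) ->
  K `&` \bigcap_(i in D) f i !=set0.
Proof.
move=> cK [x Kx] fcl totf fK.
have [[i0 Di0]|nD] := pselect (exists i, D i); last first.
  by exists x; split=> // i Di; case: nD; exists i.
pose F := filter_from D (fun i => K `&` f i).
have FF : Filter F.
  apply: filter_from_filter; first by exists i0.
  move=> i j Di Dj; have [fij|fji] := totf i j Di Dj.
    by exists i => // y [Ky fy]; split; split=> //; exact: fij.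
  by exists j => // y [Ky fy]; split; split=> //; exact: fji.
have PF : ProperFilter F by exact: filter_from_proper.
have FK : F K by exists i0 => // y [].
have [y [Ky Fy]] := cK F PF FK; exists y; split=> // i Di; apply: fcl => // U Uy.
have [|z [[_ fz] Uz]] := Fy (K `&` f i) U _ Uy; first by exists i.
by exists z.
Qed.

Section MinimalCover.
Context {H H' : profiniteGroupType} (theta : epimorphism H H').
Variable M : set H.
Hypothesis nM : normal_subgroup M.

Definition minimal_cover (C : set H) := [/\ normal_subgroup C, C `<=` M,
  theta @` C = theta @` M & forall D, normal_subgroup D -> D `<=` C ->
    theta @` D = theta @` M -> D = C].

(** The fibre of [theta] over a point of [theta M] is compact, so it meets the
intersection of a chain of covers because it meets each of them. *)
Lemma exists_minimal_cover : exists C, minimal_cover C.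
Proof.
(* Zorn's lemma is about unions of chains, hence covers are represented by
   their complements; intersecting with M makes the empty chain harmless. *)
pose P := [set A : set H | normal_subgroup (M `\` A) /\
  theta @` (M `\` A) = theta @` M].
have [Mcl M1 MF MJ] := nM.
have [F FP totF|A [[nC thC] maxA]] := @Zorn_bigcup H P.
  pose K (y : H') := M `&` theta @^-1` [set y].
  have bigE : M `\` \bigcup_(X in F) X = M `&` \bigcap_(X in F) (M `\` X).
    rewrite eqEsubset; split=> x [Mx nFx]; split=> //.
      by move=> X FX; split=> // Xx; apply: nFx; exists X.
    by move=> [X FX Xx]; have [] := nFx X FX.
  split; rewrite bigE.
    split.
    - apply: closedI => //; apply: closed_bigI => X FX.
      by have [[]] := FP X FX.
    - by split=> // X FX; have [[]] := FP X FX.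
    - move=> x y [Mx Fx] [My Fy]; split; first exact: MF.
      move=> X FX; have [[_ _ XF _] _] := FP X FX.
      by apply: XF; [exact: Fx|exact: Fy].
    - move=> x y [Mx Fx]; split; first exact: MJ.
      by move=> X FX; have [[_ _ _ XJ] _] := FP X FX; apply: XJ; exact: Fx.
  rewrite eqEsubset; split=> y; first by move=> [x [Mx _] <-]; exists x.
  move=> [x Mx thx].
  have [||X FX|X Y FX FY|X FX|z [[Mz thz] Fz]] :=
      @compact_chain_bigcap H _ F (fun X => M `\` X) (K y).
  - apply: (subclosed_compact _ profinite_compact) => //; apply: closedI => //.
    apply: preimage_closed; first by move=> ? _; exact: epi_continuous.
    exact/accessible_closed_set1/hausdorff_accessible/profinite_hausdorff.
  - by exists x.
  - by have [[]] := FP X FX.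
  - by have [XY|YX] := totF X Y FX FY; [right|left]; exact: setDS.
  - have [_ thX] := FP X FX; have : (theta @` M) y by exists x.
    by rewrite -thX => -[z [Mz nXz] thz]; exists z.
  - by exists z.
exists (M `\` A); split=> // D nD DC thD.
rewrite eqEsubset; split=> // x [Mx nAx]; apply: contrapT => nDx.
have DM : D `<=` M by move=> z /DC [].
apply: (maxA (~` D)); last by rewrite /P /= setDE setCK (setIidr DM).
by split=> [z Az /DC []//|/(_ x nDx)].
Qed.

Lemma minimal_cover_ker (C N : set H) :
  minimal_cover C -> max_normal M N -> C `&` ker theta `<=` N.
Proof.
move=> [nC CM thC minC] maxN; have [nN _ _] := maxN.
have nK : normal_subgroup (C `&` ker theta).
  by apply: normal_subgroupI => //; exact: normal_ker.
have [x [/CM]//|//|MKN] := max_normal_dichotomy nM maxN nK.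
(* Otherwise M = (C `&` ker theta) N, hence C = (C `&` ker theta) (C `&` N),
   and C `&` N is a smaller cover. *)
suff <- : C `&` N = C by move=> x [[]].
apply: minC => [|x []//|]; first exact: normal_subgroupI.
rewrite eqEsubset; split=> y; first by move=> [x [/CM Mx _] <-]; exists x.
rewrite -{1}thC => -[x Cx <-]; have [k [Ck thk] Nkx] := MKN x (CM x Cx).
exists (k^-1 * x); last by rewrite epiM epiV thk invg1 mul1g.
by split=> //; apply: (normal_subgroupM nC) => //; exact: normal_subgroupV.
Qed.

(** Both [C / (C `&` N)] and its image under [theta] are copies of [M / N],
because [C `&` N] contains the kernel of [theta] on [C]. *)
Lemma max_normal_image (C N : set H) :
  minimal_cover C -> max_normal M N -> ~ C `<=` N ->
  max_normal (theta @` M) (theta @` (C `&` N)).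
Proof.
move=> mC maxN nCN; have KN := minimal_cover_ker mC maxN.
have [nC CM thC minC] := mC; have [nN _ _] := maxN.
have nth : normal_subgroup (theta @` M) by exact: normal_image.
split=> [||P' nP' [P'M nMP'] NP'].
- by apply: normal_image; exact: normal_subgroupI.
- split=> [_ [x [/CM Mx _] <-]|]; first by exists x.
  rewrite -thC => CCN; apply: nCN => x Cx.
  have [|y [Cy Ny] thy] := CCN (theta x); first by exists x.
  rewrite -(mulgVK y x); apply: (normal_subgroupM nN) => //.
  apply: KN; split.
    by apply: (normal_subgroupM nC) => //; exact: normal_subgroupV.
  by rewrite /ker /= epiM epiV thy mulgV.
pose P := C `&` theta @^-1` P'.
have nP : normal_subgroup P.
  by apply: normal_subgroupI => //; exact: normal_preimage.
have [|PN|MPN] := max_normal_dichotomy nM maxN nP; first by move=> x [/CM].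
  rewrite eqEsubset; split=> // y P'y.
  have : (theta @` C) y by rewrite thC; exact: P'M.
  move=> [x Cx thx]; exists x => //; split=> //; apply: PN.
  by split; rewrite //= thx.
case: nMP'; rewrite -thC => _ [x Cx <-].
have [p [Cp P'p] Npx] := MPN x (CM x Cx).
rewrite -(mulVKg p x) epiM; apply: (normal_subgroupM nP') => //.
apply: NP'; exists (p^-1 * x) => //; split=> //.
by apply: (normal_subgroupM nC) => //; exact: normal_subgroupV.
Qed.

Lemma image_fundament : theta @` fundament_of M = fundament_of (theta @` M).
Proof.
rewrite eqEsubset; split.
  by apply: image_fundament_sub => //; exact: normal_image.
move=> y [My Fy]; have [C mC] := exists_minimal_cover.
have [nC CM thC minC] := mC; move: My; rewrite -thC => -[c Cc thc].
exists c => //; split=> [|N maxN]; first exact: CM.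
have [CN|nCN] := pselect (C `<=` N); first exact: CN.
have [x [Cx Nx] thx] := Fy _ (max_normal_image mC maxN nCN).
have [nN _ _] := maxN; rewrite -(mulgVK x c).
apply: (normal_subgroupM nN) => //; apply: (minimal_cover_ker mC maxN).
split; first by apply: (normal_subgroupM nC) => //; exact: normal_subgroupV.
by rewrite /ker /= epiM epiV thc thx mulgV.
Qed.

End MinimalCover.

(** * Semi-cartesian squares and the fundament series *)

(** Both conditions say that every element of [H] dying in [A] is the product
of an element of [ker eta] and an element of [ker beta]. *)
Lemma semi_cartesianC (H G B A : topologicalGroupType) (eta : epimorphism H G)
    (beta : epimorphism H B) (alpha : epimorphism B A) (phi : epimorphism G A) :
  semi_cartesian eta beta alpha phi -> semi_cartesian beta eta phi alpha.
Proof.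
move=> [comm sc]; split=> [h|]; first by rewrite comm.
rewrite eqEsubset; split=> y; rewrite /ker /=.
  by move=> [x ex <-]; rewrite comm ex epi1.
have [h <-] := epi_surj beta y; rewrite comm => pe.
have : ker phi (eta h) by [].
rewrite -sc => -[z bz ez]; exists (h / z).
  by rewrite /= epiM epiV ez mulgV.
by rewrite epiM epiV bz invg1 mulg1.
Qed.

Definition comp_epi (H G K : topologicalGroupType) (g : epimorphism G K)
  (f : epimorphism H G) : epimorphism H K.
Proof.
refine (@Epimorphism H K (g \o f) _ _ _) => [x y|x|y].
- by rewrite /= !epiM.
- by apply: continuous_comp; exact: epi_continuous.
- have [z <-] := epi_surj g y; have [x <-] := epi_surj f z.
  by exists x.
Defined.

Section FundamentLadder.
Context {H G H' G' : profiniteGroupType}.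
Variables (pi : epimorphism H G) (pi' : epimorphism H' G').
Variables (theta : epimorphism H H') (theta0 : epimorphism G G').
Hypothesis comm : forall h, pi' (theta h) = theta0 (pi h).

Lemma image_fundament_kernel_sub k :
  theta @` fundament_kernel pi k `<=` fundament_kernel pi' k.
Proof.
elim: k => [|k IHk] /=.
  by move=> _ [x + <-]; rewrite /ker /= comm => ->; rewrite epi1.
apply: image_fundament_sub => //; exact: normal_fundament_kernel.
Qed.

Lemma image_fundament_kernel k : semi_cartesian pi theta pi' theta0 ->
  theta @` fundament_kernel pi k = fundament_kernel pi' k.
Proof.
move=> sc; elim: k => [|k IHk] /=; first by have [] := semi_cartesianC sc.
by rewrite image_fundament ?IHk //; exact: normal_fundament_kernel.
Qed.

Lemma fundament_normal_sub_ker k :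
  normal_set (fundament_normal pi k.+1) `<=`
  ker (comp_epi (fundament_proj pi' k.+1) theta).
Proof.
move=> x Mx; change (ker (fundament_proj pi' k.+1) (theta x)).
by rewrite ker_fundament_proj; apply: image_fundament_kernel_sub; exists x.
Qed.

Definition fundament_theta k :
    epimorphism (fundament_group pi k) (fundament_group pi' k) :=
  if k is k'.+1 then quotient_lift (@fundament_normal_sub_ker k') else theta0.

Lemma fundament_thetaE k h :
  fundament_theta k (fundament_proj pi k h) = fundament_proj pi' k (theta h).
Proof.
case: k => [|k]; first by rewrite /= comm.
exact: quotient_liftE (@fundament_normal_sub_ker k) h.
Qed.

Lemma fundament_theta_ladder :
  fundament_ladder theta theta0 fundament_theta.
Proof.
split=> // [|k g]; first exact: fundament_thetaE.
have [h <-] := epi_surj (fundament_proj pi k.+1) g.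
by rewrite fundament_mapE !fundament_thetaE fundament_mapE.
Qed.

Variable t : forall k, epimorphism (fundament_group pi k) (fundament_group pi' k).
Hypothesis ladder : fundament_ladder theta theta0 t.

Lemma semi_cartesian_fundament_proj k : semi_cartesian pi theta pi' theta0 ->
  semi_cartesian (fundament_proj pi k) theta (fundament_proj pi' k) (t k).
Proof.
move=> sc; have [_ tE _] := ladder; apply: semi_cartesianC; split=> //.
by rewrite !ker_fundament_proj image_fundament_kernel.
Qed.

Lemma semi_cartesian_fundament_map k : semi_cartesian pi theta pi' theta0 ->
  semi_cartesian (fundament_map pi k) (t k.+1) (fundament_map pi' k) (t k).
Proof.
move=> sc; have [_ tE tmap] := ladder; split=> [g|]; first by rewrite tmap.
rewrite eqEsubset; split=> y.
  by move=> [x tx <-]; rewrite /ker /= tmap tx epi1.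
have [_ <-] := semi_cartesian_fundament_proj k sc; move=> [h thh <-].
exists (fundament_proj pi k.+1 h); last exact: fundament_mapE.
by rewrite /ker /= tE thh epi1.
Qed.

End FundamentLadder.

Lemma isomorphism_fundament (H G H' G' : profiniteGroupType)
    (pi : epimorphism H G) (pi' : epimorphism H' G')
    (theta : epimorphism H H') (theta0 : epimorphism G G')
    (t : forall k, epimorphism (fundament_group pi k) (fundament_group pi' k)) :
  (forall h, pi' (theta h) = theta0 (pi h)) ->
  fundament_ladder theta theta0 t ->
  isomorphism theta0 -> isomorphism theta -> forall k, isomorphism (t k).
Proof.
move=> comm [_ tE _] [s0 [s0K _]] [s [sK Ks]] k.
have comm' h : pi (s h) = s0 (pi' h).
  by rewrite -[in RHS](Ks h) comm s0K.
exists (fundament_theta comm' k); split=> g.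
  have [h <-] := epi_surj (fundament_proj pi k) g.
  by rewrite tE fundament_thetaE sK.
have [h <-] := epi_surj (fundament_proj pi' k) g.
by rewrite fundament_thetaE tE Ks.
Qed.

Theorem theorem9p4 (H G H' G' : profiniteGroupType)
    (pi : epimorphism H G) (pi' : epimorphism H' G')
    (theta : epimorphism H H') (theta0 : epimorphism G G')
    (comm : forall h, pi' (theta h) = theta0 (pi h)) :
  (exists t : forall k : nat,
      epimorphism (fundament_group pi k) (fundament_group pi' k),
    fundament_ladder theta theta0 t) /\
  (forall t : forall k : nat,
      epimorphism (fundament_group pi k) (fundament_group pi' k),
    fundament_ladder theta theta0 t ->
    (semi_cartesian pi theta pi' theta0 ->
      forall k,
        semi_cartesian (fundament_proj pi k) theta (fundament_proj pi' k) (t k)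
        /\ semi_cartesian (fundament_map pi k) (t k.+1)
             (fundament_map pi' k) (t k)) /\
    (isomorphism theta0 -> isomorphism theta ->
      forall k, isomorphism (t k))).
Proof.
split; first by exists (fundament_theta comm); exact: fundament_theta_ladder.
move=> t ladder; split=> [sc k|]; last exact: isomorphism_fundament comm ladder.
split; first exact: (semi_cartesian_fundament_proj ladder).
exact: (semi_cartesian_fundament_map ladder).
Qed.
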